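(* Let $(k,f)$ be the compatible pair of a Lie-Poisson structure $\pi_{k,f}$ on $\mathbb{R}^3$, and let $(K_i,F_i)\in\mathcal{C}_{k,f}$ for $i=1,2$. Then $\pi_{k,f}+\pi_{K_1,F_1}$ and $\pi_{k,f}+\pi_{K_2,F_2}$ are isomorphic (by a linear transformation) if and only if there is $T\in Aut(\pi_{k,f})$ such that $$K_2=TK_1T^{-1}\quad\text{and}\quad F_2=\det(T)\,F_1\circ T^{-1}.$$ Consequently, the classification of quadratic deformations of the Lie-Poisson structure $\pi_{k,f}$ on $\mathbb{R}^3$ is parameterized by the orbit space $Aut(\pi_{k,f})\backslash\mathcal{C}_{k,f}$, where $T$ acts by $T(K,F)=(TKT^{-1},\det(T)F\circ T^{-1})$.
   Context: All objects are real; $(x,y,z)=(x_1,x_2,x_3)$ are coordinates on $\mathbb{R}^3$. For a matrix $A=(a_{ij})$, $\hat{A}=\sum_{i,j}a_{ij}x_j\frac{\partial}{\partial x_i}$ ($I$ is the identity matrix); for $k\in\mathbb{R}^3$, $\hat{k}=\sum_ik_i\frac{\partial}{\partial x_i}$. For a function $g$, $$\pi_g=\frac{\partial g}{\partial x}\frac{\partial}{\partial y}\wedge\frac{\partial}{\partial z}+\frac{\partial g}{\partial y}\frac{\partial}{\partial z}\wedge\frac{\partial}{\partial x}+\frac{\partial g}{\partial z}\frac{\partial}{\partial x}\wedge\frac{\partial}{\partial y}.$$ A compatible pair $(k,f)$ consists of $k\in\mathbb{R}^3$ and a homogeneous quadratic polynomial $f$ with $\hat{k}f=0$; it gives the linear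 (Lie-)Poisson structure $\pi_{k,f}=\frac12\hat{I}\wedge\hat{k}+\pi_f$. $Aut(\pi_{k,f})$ is the group of $T\in GL(3)$ with $T_*\pi_{k,f}=\pi_{k,f}$. $\mathcal{C}$ is the set of pairs $(K,F)$ with $K\in\mathfrak{sl}(3)$ and $F$ a homogeneous cubic polynomial with $\hat{K}F=0$; such a pair gives the quadratic Poisson structure $\pi_{K,F}=\frac13\hat{I}\wedge\hat{K}+\pi_F$. Put $\mathcal{C}_{k,f}=\{(K,F)\in\mathcal{C}\mid[\pi_{k,f},\pi_{K,F}]=0\}$ (Schouten bracket). For $(K,F)\in\mathcal{C}_{k,f}$ the Poisson structure $\pi_{k,f}+\pi_{K,F}$ is called a quadratic deformation of $\pi_{k,f}$. Quadratic deformations of a fixed $\pi_{k,f}$ are classified up to linear transformations $T\in GL(3)$. *)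

(* Defs.v *)
From mathcomp Require Import all_boot all_order all_algebra.
From mathcomp Require Import boolp classical_sets functions reals.
From mathcomp Require Import mpoly.

Set Implicit Arguments.
Unset Strict Implicit.
Unset Printing Implicit Defensive.

Import GRing.Theory.

Local Open Scope classical_set_scope.
Local Open Scope ring_scope.

Section Definitions.

Variable R : realType.

(* All tensor fields below have polynomial coefficients. A vector field
   [\sum_i v i 0 d/dx_i] is the column of its coefficients. *)
Notation poly3 := {mpoly R[3]}.
Notation vfield := 'cV[{mpoly R[3]}]_3.

(* A bivector field is its skew-symmetric coefficient matrix: [P] stands for
   [\sum_(i < j) P i j d/dx_i /\ d/dx_j], so that [P i j = {x_i, x_j}]. *)
Notation bivector := 'M[{mpoly R[3]}]_3.

Definition linform (A : 'M[R]_3) (i : 'I_3) : poly3 := \sum_j A i j *: 'X_j.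

Definition linfield (A : 'M[R]_3) : vfield := \col_i linform A i.

Definition cstfield (k : 'cV[R]_3) : vfield := \col_i (k i 0)%:MP.

Definition vfapply (v : vfield) (g : poly3) : poly3 :=
  \sum_i v i 0 * mderiv i g.

Definition wedge (u v : vfield) : bivector := u *m v^T - v *m u^T.

Definition ix : 'I_3 := inord 0.
Definition iy : 'I_3 := inord 1.
Definition iz : 'I_3 := inord 2.

Definition dd (i : 'I_3) : vfield := delta_mx i 0.

Definition pi_fun (g : poly3) : bivector :=
  mderiv ix g *: wedge (dd iy) (dd iz)
  + mderiv iy g *: wedge (dd iz) (dd ix)
  + mderiv iz g *: wedge (dd ix) (dd iy).

(* Component [(i, j, l)] of the Schouten bracket of two bivector fields, i.e.
   the cyclic sum of [{P_ij, x_l}_Q + {Q_ij, x_l}_P]. Sign conventions for the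
   bracket differ in the literature by a global sign. *)
Definition schouten (P Q : bivector) (i j l : 'I_3) : poly3 :=
  let c a b d := \sum_m (mderiv m (P a b) * Q m d + mderiv m (Q a b) * P m d) in
  c i j l + c j l i + c l i j.

(* [x |-> g (A x)] *)
Definition comp_lin (g : poly3) (A : 'M[R]_3) : poly3 :=
  comp_mpoly [tuple linform A i | i < 3] g.

(* [(T_* P)(x) = (T /\ T) P (T^-1 x)] *)
Definition pushforward (T : 'M[R]_3) (P : bivector) : bivector :=
  let TM := map_mx (@mpolyC 3 R) T in
  TM *m map_mx (fun g => comp_lin g (invmx T)) P *m TM^T.

Definition linear_iso (P Q : bivector) : Prop :=
  exists2 T : 'M[R]_3, T \in unitmx & pushforward T P = Q.

Definition compatible (k : 'cV[R]_3) (f : poly3) : Prop :=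
  f \is 2.-homog /\ vfapply (cstfield k) f = 0.

Definition pi_lin (k : 'cV[R]_3) (f : poly3) : bivector :=
  (2^-1 : R)%:MP *: wedge (linfield 1%:M) (cstfield k) + pi_fun f.

Definition Aut_pi (k : 'cV[R]_3) (f : poly3) : set 'M[R]_3 :=
  [set T | T \in unitmx /\ pushforward T (pi_lin k f) = pi_lin k f].

Definition pi_quad (K : 'M[R]_3) (F : poly3) : bivector :=
  (3^-1 : R)%:MP *: wedge (linfield 1%:M) (linfield K) + pi_fun F.

Definition cpairs : set ('M[R]_3 * poly3) :=
  [set p | [/\ \tr p.1 = 0, p.2 \is 3.-homog & vfapply (linfield p.1) p.2 = 0]].

Definition cpairs_of (k : 'cV[R]_3) (f : poly3) : set ('M[R]_3 * poly3) :=
  [set p | cpairs p /\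
    forall i j l, schouten (pi_lin k f) (pi_quad p.1 p.2) i j l = 0].

Definition deformation (k : 'cV[R]_3) (f : poly3) (p : 'M[R]_3 * poly3) :
  bivector := pi_lin k f + pi_quad p.1 p.2.

Definition quad_deformations (k : 'cV[R]_3) (f : poly3) : set bivector :=
  deformation k f @` cpairs_of k f.

Definition iso_class (k : 'cV[R]_3) (f : poly3) (P : bivector) : set bivector :=
  [set Q | quad_deformations k f Q /\ linear_iso P Q].

Definition iso_classes (k : 'cV[R]_3) (f : poly3) : set (set bivector) :=
  iso_class k f @` quad_deformations k f.

Definition act (T : 'M[R]_3) (p : 'M[R]_3 * poly3) : 'M[R]_3 * poly3 :=
  (T *m p.1 *m invmx T, (\det T) *: comp_lin p.2 (invmx T)).

(* Subgroups of GL(3), and actions of such a subgroup on a set. *)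
Definition GL_subgroup (G : set 'M[R]_3) : Prop :=
  [/\ forall T, G T -> T \in unitmx, G 1%:M,
      forall S T, G S -> G T -> G (S *m T) & forall T, G T -> G (invmx T)].

Definition is_action (X : Type) (G : set 'M[R]_3) (to : 'M[R]_3 -> X -> X)
    (D : set X) : Prop :=
  [/\ forall T p, G T -> D p -> D (to T p), forall p, D p -> to 1%:M p = p
    & forall S T p, G S -> G T -> D p -> to (S *m T) p = to S (to T p)].

Definition act_orbit (X : Type) (G : set 'M[R]_3) (to : 'M[R]_3 -> X -> X) (p : X) :
  set X := [set to T p | T in G].

Definition act_orbit_space (X : Type) (G : set 'M[R]_3) (to : 'M[R]_3 -> X -> X)
  (D : set X) : set (set X) := act_orbit G to @` D.

End Definitions.

(* Main.v *)
Require Import Defs.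
From HB Require Import structures.
From mathcomp Require Import all_boot all_order all_algebra.
From mathcomp Require Import boolp classical_sets functions reals.
From mathcomp Require Import mpoly.
From mathcomp Require Import ring.
Set Implicit Arguments.
Unset Strict Implicit.
Unset Printing Implicit Defensive.
Import GRing.Theory Num.Theory.
Local Open Scope classical_set_scope.
Local Open Scope ring_scope.

(** Two facts carry the theorem.

    The first is equivariance: [T] in GL(3) sends pi_(K,F) to the structure of
    the pair T.(K,F) = (T K T^-1, det(T) F o T^-1) ([pushforward_pi_quad]).
    Since [T] fixes the Euler field, the term I /\ K only sees [K] conjugated;
    and pi_F is the cross-product matrix of the gradient of [F], so the chain
    rule together with the behaviour of the cross product under a linear map
    ([crossmx_congr]) produces the factor det(T).

    The second is that (K,F) can be read off pi_(K,F) ([pi_quad_inj]).  The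
    divergence of pi_F vanishes, by symmetry of second derivatives, whereas
    that of I /\ K is tr(K) I - 3 K.  As [K] is traceless, the divergence
    of pi_(K,F), which is its modular vector field up to sign, is - K.  Then
    the gradient of [F] is known too, and it determines [F], whose degree is
    positive.

    Now let [T] carry pi_(k,f) + pi_(K1,F1) to pi_(k,f) + pi_(K2,F2).  Linear
    changes of coordinates preserve the degree of the coefficients, so the
    parts of degree 1 and 2 can be compared separately
    ([homog_entries_split]).  In degree 1 this says that [T] is an automorphism
    of pi_(k,f); in degree 2 that pi_(T.(K1,F1)) = pi_(K2,F2), hence
    T.(K1,F1) = (K2,F2).  Each step can be reversed.

    For the orbit space it remains to see that Aut(pi_(k,f)) acts on C_(k,f).
    The compatibility condition is preserved because the Schouten bracket is
    a tensor: the bracket of two transported bivectors is the transport of their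
    bracket ([schouten_pushforward]).  Orbits and isomorphism classes of
    deformations then correspond. *)

(** * Polynomials and linear substitutions *)

Section Poly.
Variable R : realType.
Notation poly3 := {mpoly R[3]}.
Implicit Types (A B S T : 'M[R]_3) (g : poly3).

(** Constants and variables generate the polynomial ring.  Substitutions and
    derivations are determined on generators, so this is the induction behind
    every identity between them below. *)
Lemma mpoly_ring_ind (P : poly3 -> Prop) :
  (forall c, P c%:MP) -> (forall i, P 'X_i) ->
  (forall p q, P p -> P q -> P (p + q)) ->
  (forall p q, P p -> P q -> P (p * q)) -> forall p, P p.
Proof.
move=> PC PX PD PM; elim/mpolyind => [|c m p _ _ Pp]; first by rewrite -mpolyC0.
apply: PD => //; rewrite -mul_mpolyC; apply: (PM) => //.
rewrite mpolyXE_id; apply: (big_ind P) => [||i _]; [by rewrite -mpolyC1 | by [] |].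
by elim: (m i) => [|n IHn]; [rewrite expr0 -mpolyC1 | rewrite exprS; apply: PM].
Qed.

(** The matrix comes first, unlike in [comp_lin], so that substitution along a
    fixed matrix is a function that can be declared a ring morphism. *)
Definition pullback A : poly3 -> poly3 := comp_mpoly [tuple linform A i | i < 3].

HB.instance Definition _ A := GRing.RMorphism.copy (pullback A)
  (comp_mpoly [tuple linform A i | i < 3]).

Lemma comp_linE g A : comp_lin g A = pullback A g. Proof. by []. Qed.

Lemma pullbackC A c : pullback A c%:MP = c%:MP.
Proof. exact: comp_mpolyC. Qed.

Lemma pullbackZ A c g : pullback A (c *: g) = c *: pullback A g.
Proof. exact: comp_mpolyZ. Qed.

Lemma pullbackX A i : pullback A 'X_i = linform A i.
Proof. by rewrite /pullback comp_mpolyXU -tnth_nth tnth_mktuple. Qed.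

Lemma pullback_linform A B i : pullback B (linform A i) = linform (A *m B) i.
Proof.
rewrite /linform rmorph_sum /=.
under eq_bigr do rewrite pullbackZ pullbackX scaler_sumr.
rewrite exchange_big /=; apply: eq_bigr => j _; rewrite mxE scaler_suml.
by apply: eq_bigr => l _; rewrite scalerA.
Qed.

Lemma linform1 i : linform (1%:M : 'M[R]_3) i = 'X_i.
Proof.
rewrite /linform (bigD1 i) //= mxE eqxx scale1r big1 ?addr0 // => j ji.
by rewrite mxE eq_sym (negbTE ji) scale0r.
Qed.

Lemma pullback1 g : pullback 1%:M g = g.
Proof.
elim/mpoly_ring_ind: g => [c|i|p q IHp IHq|p q IHp IHq].
- exact: pullbackC.
- by rewrite pullbackX linform1.
- by rewrite rmorphD /= IHp IHq.
- by rewrite rmorphM /= IHp IHq.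
Qed.

Lemma pullback_comp A B g : pullback B (pullback A g) = pullback (A *m B) g.
Proof.
elim/mpoly_ring_ind: g => [c|i|p q IHp IHq|p q IHp IHq].
- by rewrite !pullbackC.
- by rewrite !pullbackX pullback_linform.
- by rewrite !rmorphD /= IHp IHq.
- by rewrite !rmorphM /= IHp IHq.
Qed.

Lemma mderiv_Xi i j : mderiv i 'X_j = (i == j)%:R :> poly3.
Proof.
rewrite mderivX mnm1E eq_sym; case: eqVneq => [->|_]; last by rewrite scale0r.
by rewrite -{1}[U_(j)%MM]add0m addmK mpolyX0 scale1r.
Qed.

Lemma mderiv_linform i A j : mderiv i (linform A j) = (A j i)%:MP.
Proof.
rewrite /linform linear_sum /= (bigD1 i) //= mderivZ mderiv_Xi eqxx.
rewrite alg_mpolyC big1 ?addr0 // => l li.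
by rewrite mderivZ mderiv_Xi eq_sym (negbTE li) scaler0.
Qed.

Definition grad g : 'cV[poly3]_3 := \col_i mderiv i g.

Notation polymx := (map_mx (@mpolyC 3 R)).

Lemma gradE g i : grad g i 0 = mderiv i g.
Proof. by rewrite mxE. Qed.

(** The chain rule.  Both sides are derivations along [pullback A], hence
    agree once they agree on the variables. *)
Lemma grad_pullback A g :
  grad (pullback A g) = (polymx A)^T *m map_mx (pullback A) (grad g).
Proof.
elim/mpoly_ring_ind: g => [c|j|p q IHp IHq|p q IHp IHq];
  apply/colP => i; rewrite mxE.
- rewrite pullbackC mderivC mxE big1 // => l _.
  by rewrite !mxE mderivC rmorph0 mulr0.
- rewrite pullbackX mderiv_linform mxE (bigD1 j) //= !mxE mderiv_Xi eqxx rmorph1.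
  rewrite mulr1 big1 ?addr0 // => l lj.
  by rewrite !mxE mderiv_Xi (negbTE lj) rmorph0 mulr0.
- rewrite rmorphD /= mderivD -!gradE IHp IHq !mxE -big_split /=.
  by apply: eq_bigr => l _; rewrite !mxE mderivD rmorphD mulrDr.
- rewrite rmorphM /= mderivM -!gradE IHp IHq !mxE mulr_suml mulr_sumr -big_split /=.
  apply: eq_bigr => l _; rewrite !mxE mderivM rmorphD !rmorphM /=; ring.
Qed.

Lemma dhomog_bigprod (I : finType) (d : I -> nat) (p : I -> poly3) :
  (forall i, p i \is (d i).-homog) -> \prod_i p i \is (\sum_i d i).-homog.
Proof.
move=> hp; elim/big_rec2: _ => [|i a e _ ih]; first exact: dhomog1.
exact: dhomogM.
Qed.

Lemma dhomog_linform A i : linform A i \is 1.-homog.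
Proof.
by apply: rpred_sum => j _; apply: dhomogZ; rewrite dhomogX /= mdeg1.
Qed.

Lemma dhomog_pullback d A g : g \is d.-homog -> pullback A g \is d.-homog.
Proof.
move=> /dhomogP hg; rewrite /pullback comp_mpolyE big_seq.
apply: rpred_sum => m /hg hm; apply: dhomogZ.
have <- : (\sum_i m i)%N = d by rewrite -mdegE.
apply: dhomog_bigprod => i; rewrite tnth_mktuple.
by have := dhomogMn (m i) (dhomog_linform A i); rewrite mul1n.
Qed.

Lemma dhomog_mderiv d i g : g \is d.+1.-homog -> mderiv i g \is d.-homog.
Proof.
move=> hg; apply/dhomogP => m; rewrite mcoeff_msupp mcoeff_mderiv => nz.
have : (m + U_(i))%MM \in msupp g.
  by rewrite mcoeff_msupp; apply: contraNneq nz => ->; rewrite mul0rn.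
by move/(dhomog_mf hg); rewrite /= mdegD mdeg1 addn1 => -[].
Qed.

(** In positive degree each monomial contains some variable, and
    differentiating along it multiplies the coefficient by a nonzero
    integer. *)
Lemma homog_grad_eq0 d g : g \is d.+1.-homog -> grad g = 0 -> g = 0.
Proof.
move=> hg g0; apply/mpolyP => m; rewrite mcoeff0; apply/eqP/negPn/negP => nz.
have dm : mdeg m = d.+1 by apply: (dhomog_mf hg); rewrite mcoeff_msupp.
have [i mi] : exists i, (0 < m i)%N.
  have : (0 < \sum_i m i)%N by rewrite -mdegE dm.
  rewrite lt0n sum_nat_eq0 negb_forall => /existsP[i].
  by rewrite implyTb -lt0n; exists i.
have := congr1 (fun v : 'cV_3 => (v i 0)@_(m - U_(i))) g0.
rewrite !mxE mcoeff_mderiv submK ?lep1mP -?lt0n //.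
by rewrite mcoeff0 => /eqP; rewrite mulrn_eq0 (negbTE nz).
Qed.

End Poly.

(** * The cross-product matrix *)

(** The matrix of [u] seen as a bivector, for which a^T [crossmx u] b is the
    determinant of the triple (a, b, u). *)
Definition crossmx (U : comNzRingType) (u : 'cV[U]_3) : 'M[U]_3 :=
  \matrix_(i, j)
    match (i : nat), (j : nat) with
    | 0%N, 1%N => u iz 0 | 1%N, 0%N => - u iz 0
    | 1%N, 2%N => u ix 0 | 2%N, 1%N => - u ix 0
    | 2%N, 0%N => u iy 0 | 0%N, 2%N => - u iy 0
    | _, _ => 0
    end.

Lemma ord3P (P : 'I_3 -> Prop) : P ix -> P iy -> P iz -> forall i, P i.
Proof.
move=> p0 p1 p2 [[|[|[|//]]] h].
- by have <- : ix = Ordinal h by apply/val_inj; rewrite /= inordK.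
- by have <- : iy = Ordinal h by apply/val_inj; rewrite /= inordK.
- by have <- : iz = Ordinal h by apply/val_inj; rewrite /= inordK.
Qed.

Lemma sum3 (V : nmodType) (F : 'I_3 -> V) : \sum_i F i = F ix + F iy + F iz.
Proof.
rewrite 3!big_ord_recl big_ord0 addr0 addrA; congr (F _ + F _ + F _);
  by apply/val_inj; rewrite /= inordK.
Qed.

Lemma det3 (U : comNzRingType) (M : 'M[U]_3) :
  \det M = M ix ix * (M iy iy * M iz iz - M iy iz * M iz iy)
         - M ix iy * (M iy ix * M iz iz - M iy iz * M iz ix)
         + M ix iz * (M iy ix * M iz iy - M iy iy * M iz ix).
Proof.
(* Indexing by naturals lets the lifted ordinals of the expansion compute. *)
pose f a b := M (inord a) (inord b).
have -> : M = \matrix_(i, j) f i j by apply/matrixP=> i j; rewrite mxE /f !inord_val.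
rewrite (expand_det_row _ ord0) !big_ord_recl big_ord0 /cofactor.
rewrite !(expand_det_row _ ord0) !big_ord_recl !big_ord0 /cofactor !det_mx11 !mxE /=.
rewrite /bump /= !inordK //; ring.
Qed.

(** The triple product scales by the determinant:
    det(M^T a, M^T b, M^T w) = det(M) det(a, b, w). *)
Lemma crossmx_congr (U : comNzRingType) (M : 'M[U]_3) (w : 'cV_3) :
  M *m crossmx (M^T *m w) *m M^T = \det M *: crossmx w.
Proof.
apply/matrixP => i j; rewrite !mxE sum3 !mxE !sum3 !mxE !inordK //= !sum3 !mxE det3.
by elim/ord3P: i; elim/ord3P: j; rewrite !inordK //=; ring.
Qed.

Lemma crossmxE (U : comNzRingType) (u : 'cV[U]_3) :
  (crossmx u ix ix = 0) * (crossmx u ix iy = u iz 0) * (crossmx u ix iz = - u iy 0)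
  * (crossmx u iy ix = - u iz 0) * (crossmx u iy iy = 0) * (crossmx u iy iz = u ix 0)
  * (crossmx u iz ix = u iy 0) * (crossmx u iz iy = - u ix 0) * (crossmx u iz iz = 0).
Proof. by rewrite !mxE !inordK. Qed.

Lemma axis_neq : ((ix == iy) = false) * ((ix == iz) = false) * ((iy == ix) = false)
  * ((iy == iz) = false) * ((iz == ix) = false) * ((iz == iy) = false).
Proof. by rewrite -!val_eqE /= !inordK. Qed.

Lemma crossmxZ (U : comNzRingType) (a : U) u : crossmx (a *: u) = a *: crossmx u.
Proof.
apply/matrixP => i j; rewrite !mxE.
by elim/ord3P: i; elim/ord3P: j; rewrite !inordK //= ?mxE ?mulrN ?mulr0.
Qed.

Lemma crossmx_inj (U : comNzRingType) : injective (@crossmx U).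
Proof.
move=> u v E; apply/colP; elim/ord3P.
- by have := congr1 (fun M : 'M_3 => M iy iz) E; rewrite !mxE !inordK.
- by have := congr1 (fun M : 'M_3 => M iz ix) E; rewrite !mxE !inordK.
- by have := congr1 (fun M : 'M_3 => M ix iy) E; rewrite !mxE !inordK.
Qed.

(** * Bivector fields and linear maps *)

Section Tensors.
Variable R : realType.
Notation poly3 := {mpoly R[3]}.
Notation polymx := (map_mx (@mpolyC 3 R)).
Notation pullmx A := (map_mx (pullback A)).
Implicit Types (A B S T K : 'M[R]_3) (g F : poly3) (P Q : 'M[poly3]_3).

Lemma wedge_congr (M : 'M[poly3]_3) (u v : 'cV_3) :
  wedge (M *m u) (M *m v) = M *m wedge u v *m M^T.
Proof. by rewrite /wedge mulmxBr mulmxBl !trmx_mul !mulmxA. Qed.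

Lemma wedgeE (u v : 'cV[poly3]_3) i j : wedge u v i j = u i 0 * v j 0 - v i 0 * u j 0.
Proof. by rewrite !mxE !big_ord1 !mxE. Qed.

Lemma wedge_dd i j : wedge (dd R i) (dd R j) = delta_mx i j - delta_mx j i.
Proof. by rewrite /wedge /dd !trmx_delta !mul_delta_mx. Qed.

(** In this form pi_g inherits both the chain rule for gradients and the
    transformation law of the cross product. *)
Lemma pi_funE g : pi_fun g = crossmx (grad g).
Proof.
apply/matrixP => i j; rewrite /pi_fun !wedge_dd !mxE.
by elim/ord3P: i; elim/ord3P: j; rewrite !inordK ?gradE ?eqxx ?axis_neq /=
  ?subrr ?mulr0 ?addr0 ?add0r ?subr0 ?sub0r ?mulrN1 ?mulr1.
Qed.

Lemma gradZ c g : grad (c *: g) = c%:MP *: grad g.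
Proof. by apply/colP => i; rewrite mxE [RHS]mxE gradE mderivZ mul_mpolyC. Qed.

Lemma pi_funZ c g : pi_fun (c *: g) = c%:MP *: pi_fun g.
Proof. by rewrite !pi_funE gradZ crossmxZ. Qed.

Lemma linfieldE A : linfield A = polymx A *m linfield 1%:M.
Proof.
apply/colP => i; rewrite !mxE; apply: eq_bigr => j _.
by rewrite !mxE linform1 mul_mpolyC.
Qed.

Lemma pullmx_linfield A B : pullmx B (linfield A) = linfield (A *m B).
Proof. by apply/colP => i; rewrite !mxE pullback_linform. Qed.

Lemma pullmxM m n p A (P : 'M[poly3]_(m, n)) (Q : 'M[poly3]_(n, p)) :
  pullmx A (P *m Q) = pullmx A P *m pullmx A Q.
Proof. exact: map_mxM. Qed.

Lemma pullmx_tr m n A (P : 'M[poly3]_(m, n)) : pullmx A P^T = (pullmx A P)^T.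
Proof. by rewrite map_trmx. Qed.

Lemma pullmx_comp m n A B (P : 'M[poly3]_(m, n)) :
  pullmx B (pullmx A P) = pullmx (A *m B) P.
Proof. by apply/matrixP => i j; rewrite [LHS]mxE [in LHS]mxE [RHS]mxE pullback_comp. Qed.

Lemma pullmx_polymx m n A (B : 'M[R]_(m, n)) : pullmx A (polymx B) = polymx B.
Proof. by apply/matrixP => i j; rewrite !mxE pullbackC. Qed.

Lemma polymx_mul_linfield A B : polymx A *m linfield B = linfield (A *m B).
Proof. by rewrite linfieldE mulmxA -map_mxM -linfieldE. Qed.

Lemma pullmx_wedge A (u v : 'cV[poly3]_3) :
  pullmx A (wedge u v) = wedge (pullmx A u) (pullmx A v).
Proof. by rewrite /wedge map_mxB !pullmxM !pullmx_tr. Qed.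

Lemma pullmx_crossmx A (u : 'cV[poly3]_3) :
  pullmx A (crossmx u) = crossmx (pullmx A u).
Proof.
by apply/matrixP => i j; elim/ord3P: i; elim/ord3P: j;
  rewrite !mxE !inordK //= ?mxE ?rmorphN ?rmorph0.
Qed.

Lemma pushforwardE T P :
  pushforward T P = polymx T *m pullmx (invmx T) P *m (polymx T)^T.
Proof. by []. Qed.

Lemma pushforwardD T P Q : pushforward T (P + Q) = pushforward T P + pushforward T Q.
Proof. by rewrite !pushforwardE map_mxD mulmxDr mulmxDl. Qed.

Lemma pushforward1 P : pushforward 1%:M P = P.
Proof.
rewrite pushforwardE invmx1 map_mx1 trmx1 mulmx1 mul1mx.
by apply/matrixP => i j; rewrite mxE pullback1.
Qed.

Lemma pushforwardM S T P : S \in unitmx -> T \in unitmx ->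
  pushforward (S *m T) P = pushforward S (pushforward T P).
Proof.
move=> uS uT; rewrite !pushforwardE (invrM uS uT : invmx (S *m T) = _).
rewrite -pullmx_comp pullmxM pullmxM pullmx_tr !pullmx_polymx.
by rewrite map_mxM trmx_mul !mulmxA.
Qed.

(** The Euler field is invariant, so only [K] is conjugated in the first
    summand.  In the second, T [crossmx (T^T w)] T^T = det(T) [crossmx w] is
    used for w the gradient of F o T^-1, as T^T w is then the gradient of [F]
    taken at T^-1 x. *)
Lemma pushforward_pi_quad T K F : T \in unitmx ->
  pushforward T (pi_quad K F) =
    pi_quad (T *m K *m invmx T) (\det T *: comp_lin F (invmx T)).
Proof.
move=> uT; rewrite /pi_quad pushforwardD; congr (_ + _).
  rewrite pushforwardE map_mxZ /= pullbackC -scalemxAr -scalemxAl; congr (_ *: _).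
  rewrite pullmx_wedge !pullmx_linfield -wedge_congr !polymx_mul_linfield.
  by rewrite mul1mx (mulmxV uT) (mulmxA T K).
rewrite pushforwardE pi_funZ !pi_funE pullmx_crossmx comp_linE grad_pullback.
rewrite -(det_map_mx (@mpolyC 3 R)) -crossmx_congr mulmxA -trmx_mul -map_mxM.
by rewrite (mulVmx uT) map_mx1 trmx1 mul1mx.
Qed.

Definition homog_entries d P := forall i j, P i j \is d.-homog.

Lemma homog_entriesD d P Q :
  homog_entries d P -> homog_entries d Q -> homog_entries d (P + Q).
Proof. by move=> hP hQ i j; rewrite mxE rpredD. Qed.

Lemma homog_entries_wedge d e (u v : 'cV[poly3]_3) :
  (forall i, u i 0 \is d.-homog) -> (forall i, v i 0 \is e.-homog) ->
  homog_entries (d + e) (wedge u v).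
Proof.
move=> hu hv i j; rewrite !mxE !big_ord1 !mxE rpredB //; first exact: dhomogM.
by rewrite mulrC; apply: dhomogM.
Qed.

Lemma homog_entriesZ d (c : R) P : homog_entries d P -> homog_entries d (c%:MP *: P).
Proof. by move=> hP i j; rewrite mxE mul_mpolyC; apply: dhomogZ. Qed.

Lemma homog_entries_pi_fun d g : g \is d.+1.-homog -> homog_entries d (pi_fun g).
Proof.
move=> hg i j; rewrite pi_funE.
elim/ord3P: i; elim/ord3P: j; rewrite mxE !inordK //= ?gradE ?rpredN;
  by [exact: dhomog_mderiv | exact: rpred0].
Qed.

Lemma homog_pi_lin (k : 'cV[R]_3) f : f \is 2.-homog -> homog_entries 1 (pi_lin k f).
Proof.
move=> hf; apply: homog_entriesD; last exact: homog_entries_pi_fun.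
apply/homog_entriesZ; apply: (@homog_entries_wedge 1 0) => i.
  by rewrite mxE; apply: dhomog_linform.
by rewrite mxE -alg_mpolyC; apply/dhomogZ/dhomog1.
Qed.

Lemma homog_pi_quad K F : F \is 3.-homog -> homog_entries 2 (pi_quad K F).
Proof.
move=> hF; apply: homog_entriesD; last exact: homog_entries_pi_fun.
apply/homog_entriesZ; apply: (@homog_entries_wedge 1 1) => i;
  by rewrite mxE; apply: dhomog_linform.
Qed.

Lemma homog_pushforward d T P : homog_entries d P -> homog_entries d (pushforward T P).
Proof.
move=> hP i j; rewrite pushforwardE mxE; apply: rpred_sum => a _.
rewrite !mxE mulrC mul_mpolyC; apply: dhomogZ; apply: rpred_sum => b _.
by rewrite !mxE mul_mpolyC; apply/dhomogZ/dhomog_pullback.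
Qed.

(** A difference that is homogeneous of two distinct degrees is zero. *)
Lemma homog_entries_split d e P Q P' Q' : d != e ->
  homog_entries d P -> homog_entries d P' ->
  homog_entries e Q -> homog_entries e Q' ->
  P + Q = P' + Q' -> P = P' /\ Q = Q'.
Proof.
move=> de hP hP' hQ hQ' EPQ.
have E : P - P' = Q' - Q by rewrite -[P](addrK Q) EPQ [P' + Q']addrC addrAC addrK.
suff EP : P = P' by split=> //; apply: (@addrI _ P'); rewrite -EPQ EP.
apply/matrixP => i j; apply/eqP; rewrite -subr_eq0; apply/negPn/negP => nz.
move: de => /eqP; apply; apply: (dhomog_uniq nz); first by apply: rpredB; [exact: hP | exact: hP'].
by have := congr1 (fun M : 'M_3 => M i j) E; rewrite !mxE => ->;
  apply: rpredB; [exact: hQ' | exact: hQ].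
Qed.

(** For a Poisson bivector this is, up to sign, its modular vector field with
    respect to the standard volume. *)
Definition divergence P : 'cV[poly3]_3 := \col_i \sum_j mderiv j (P i j).

(** Row by row this is curl grad = 0: second partial derivatives commute. *)
Lemma divergence_pi_fun g : divergence (pi_fun g) = 0.
Proof.
apply/colP => i; rewrite [LHS]mxE [RHS]mxE sum3 pi_funE.
elim/ord3P: i; rewrite !crossmxE !gradE ?mderivN mderiv0 ?addr0 ?add0r.
- by rewrite (mderiv_comm iz iy) subrr.
- by rewrite (mderiv_comm iz ix) addrC subrr.
- by rewrite (mderiv_comm iy ix) subrr.
Qed.

Lemma divergenceD P Q : divergence (P + Q) = divergence P + divergence Q.
Proof.
apply/colP => i; rewrite [LHS]mxE [RHS]mxE [divergence P i 0]mxE [divergence Q i 0]mxE.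
by rewrite -big_split; apply: eq_bigr => j _; rewrite [in LHS]mxE mderivD.
Qed.

Lemma divergenceZ (c : R) P : divergence (c%:MP *: P) = c%:MP *: divergence P.
Proof.
apply/colP => i; rewrite [LHS]mxE [RHS]mxE [divergence P i 0]mxE mulr_sumr.
by apply: eq_bigr => j _; rewrite [in LHS]mxE mderiv_mulC.
Qed.

(** Row [i] of the wedge is the vector field x_i (K x) - (K x)_i x, whose
    divergence is (K x)_i + x_i tr(K) - (K x)_i - 3 (K x)_i. *)
Lemma divergence_wedge_linfield K :
  divergence (wedge (linfield 1%:M) (linfield K))
    = (\tr K)%:MP *: linfield 1%:M - 3%:R *: linfield K.
Proof.
apply/colP => i; rewrite [LHS]mxE.
have E j : mderiv j (wedge (linfield 1%:M) (linfield K) i j) =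
    (i == j)%:R%:MP * linform K j + 'X_i * (K j j)%:MP
    - ((K i j)%:MP * 'X_j + linform K i).
  rewrite wedgeE ![linfield _ _ _]mxE !linform1 mderivB !mderivM !mderiv_linform.
  by rewrite !mderiv_Xi eqxx mulr1 eq_sym mpolyC_nat.
rewrite (eq_bigr _ (fun j _ => E j)) !big_split /= sumrN big_split /=.
rewrite sumr_const card_ord -mulr_sumr.
have -> : \sum_j (i == j)%:R%:MP * linform K j = linform K i.
  rewrite (bigD1 i) //= eqxx mul1r big1 ?addr0 // => j ji.
  by rewrite eq_sym (negbTE ji) mul0r.
have -> : \sum_j (K i j)%:MP * 'X_j = linform K i.
  by apply: eq_bigr => j _; rewrite mul_mpolyC.
have -> : \sum_j (K j j)%:MP = (\tr K)%:MP :> poly3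
  by rewrite /mxtrace rmorph_sum.
rewrite [RHS]mxE [X in _ = X + _]mxE [X in _ = _ + X]mxE [X in _ = _ - X]mxE
  ![linfield _ _ _]mxE linform1.
rewrite -mulr_natl; ring.
Qed.

(** Tracelessness of [K] kills the multiple of the Euler field, and the
    coefficient 1/3 in [pi_quad] makes the rest exactly - K. *)
Lemma divergence_pi_quad K F : \tr K = 0 -> divergence (pi_quad K F) = - linfield K.
Proof.
move=> trK; rewrite divergenceD divergence_pi_fun addr0 divergenceZ.
rewrite divergence_wedge_linfield trK mpolyC0 scale0r add0r scalerN scalerA.
by rewrite -mpolyC_nat -mpolyCM mulVf ?pnatr_eq0 // mpolyC1 scale1r.
Qed.

Lemma linfield_inj K1 K2 : linfield K1 = linfield K2 -> K1 = K2.
Proof.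
move=> E; apply/matrixP => i j.
have := congr1 (fun v : 'cV_3 => (mderiv j (v i 0))@_0%MM) E.
by rewrite !mxE !mderiv_linform !mcoeffC eqxx !mulr1.
Qed.

(** The divergence recovers [K]; what is left is pi_F, which gives the
    gradient of [F], hence [F] itself. *)
Lemma pi_quad_inj (p q : 'M[R]_3 * poly3) : cpairs p -> cpairs q ->
  pi_quad p.1 p.2 = pi_quad q.1 q.2 -> p = q.
Proof.
case: p q => [K1 F1] [K2 F2] [/= tr1 h1 _] [/= tr2 h2 _] E.
have EK : K1 = K2.
  apply/linfield_inj/oppr_inj.
  by rewrite -(divergence_pi_quad F1 tr1) -(divergence_pi_quad F2 tr2) E.
move: E; rewrite /pi_quad EK => /(@addrI _ _); rewrite !pi_funE => /crossmx_inj E.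
congr (_, _); apply/eqP; rewrite -subr_eq0; apply/eqP.
apply: (@homog_grad_eq0 _ 2); first exact: rpredB.
apply/colP => i; have := congr1 (fun v : 'cV_3 => v i 0) E.
by rewrite !mxE mderivB => ->; rewrite subrr.
Qed.

End Tensors.

(** * Tensoriality of the Schouten bracket *)

Section Equivariance.
Variable R : realType.
Notation poly3 := {mpoly R[3]}.
Notation polymx := (map_mx (@mpolyC 3 R)).
Notation pullmx A := (map_mx (pullback A)).
Implicit Types (A B S T K : 'M[R]_3) (k : 'cV[R]_3) (f g F : poly3).
Implicit Types (P Q : 'M[poly3]_3) (p q : 'M[R]_3 * poly3).

(** The Schouten bracket is a cyclic sum of terms in which one bivector is
    differentiated along the Hamiltonian fields of the other. *)
Definition half_schouten P Q (a b d : 'I_3) : poly3 := \sum_m mderiv m (P a b) * Q m d.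

Lemma half_schoutenE P Q a b d : half_schouten P Q a b d = ((grad (P a b))^T *m Q) 0 d.
Proof.
rewrite [RHS]mxE; apply: eq_bigr => m _.
by rewrite [_^T 0 m]mxE gradE.
Qed.

(** The coefficients of T_* H for a 3-tensor field [H]. *)
Definition transport T (H : 'I_3 -> 'I_3 -> 'I_3 -> poly3) (a b d : 'I_3) : poly3 :=
  \sum_i \sum_j \sum_l
    (T a i)%:MP * (T b j)%:MP * (T d l)%:MP * pullback (invmx T) (H i j l).

Lemma congr_mxE (M P : 'M[poly3]_3) a b :
  (M *m P *m M^T) a b = \sum_i \sum_j M a i * M b j * P i j.
Proof.
rewrite exchange_big mxE; apply: eq_bigr => j _; rewrite [_^T j b]mxE mxE mulr_suml.
by apply: eq_bigr => i _; rewrite mulrAC.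
Qed.

Lemma pushforward_entry T P a b : pushforward T P a b =
  \sum_i \sum_j (T a i)%:MP * (T b j)%:MP * pullback (invmx T) (P i j).
Proof.
rewrite pushforwardE congr_mxE; apply: eq_bigr => i _; apply: eq_bigr => j _.
by rewrite [polymx T a i]mxE [polymx T b j]mxE [pullmx _ _ i j]mxE.
Qed.

(** [half_schouten] is tensorial for linear maps because the coefficients of
    [T] are constant: differentiating T_* P meets only the coefficients of
    [P], and the factor T^-1 from the chain rule cancels the left factor
    [T] of T_* Q. *)
Lemma half_schouten_pushforward T P Q a b d : T \in unitmx ->
  half_schouten (pushforward T P) (pushforward T Q) a b d
    = transport T (half_schouten P Q) a b d.
Proof.
move=> uT.
have gradT : grad (pushforward T P a b) = \sum_i \sum_j
    ((T a i)%:MP * (T b j)%:MP) *: grad (pullback (invmx T) (P i j)).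
  apply/colP => m; rewrite gradE pushforward_entry summxE linear_sum.
  apply: eq_bigr => i _; rewrite summxE linear_sum /=; apply: eq_bigr => j _.
  by rewrite /= [RHS]mxE gradE -mulrA !mderiv_mulC mulrA.
rewrite half_schoutenE gradT linear_sum /= mulmx_suml summxE; apply: eq_bigr => i _.
rewrite linear_sum /= mulmx_suml summxE; apply: eq_bigr => j _.
rewrite linearZ /= -scalemxAl [LHS]mxE grad_pullback trmx_mul trmxK pushforwardE.
rewrite !mulmxA -(mulmxA _ (polymx (invmx T))) -map_mxM (mulVmx uT) map_mx1 mulmx1.
rewrite -pullmx_tr -pullmxM [X in _ * X]mxE mulr_sumr; apply: eq_bigr => l _.
rewrite [_^T l d]mxE [polymx T d l]mxE [pullmx _ _ 0 l]mxE -half_schoutenE.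
by rewrite [pullback _ _ * _]mulrC !mulrA.
Qed.

Lemma schoutenE P Q i j l : schouten P Q i j l =
  (half_schouten P Q i j l + half_schouten Q P i j l)
  + (half_schouten P Q j l i + half_schouten Q P j l i)
  + (half_schouten P Q l i j + half_schouten Q P l i j).
Proof. by rewrite /schouten !big_split. Qed.

(** Transport treats its three slots alike, so it commutes with the cyclic
    permutation used in the bracket. *)
Lemma transport_cycle T H a b d :
  transport T H b d a = transport T (fun i j l => H j l i) a b d.
Proof.
rewrite /transport; under eq_bigr do rewrite exchange_big.
rewrite exchange_big; apply: eq_bigr => i _; apply: eq_bigr => j _.
by apply: eq_bigr => l _; congr (_ * _); ring.
Qed.

Lemma transportD T H1 H2 a b d : transport T H1 a b d + transport T H2 a b d =
  transport T (fun i j l => H1 i j l + H2 i j l) a b d.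
Proof.
rewrite -big_split; apply: eq_bigr => i _; rewrite -big_split; apply: eq_bigr => j _.
by rewrite -big_split; apply: eq_bigr => l _; rewrite rmorphD mulrDr.
Qed.

(** Each of the six terms of the bracket is tensorial, and transport commutes
    with their cyclic sum. *)
Lemma schouten_pushforward T P Q a b d : T \in unitmx ->
  schouten (pushforward T P) (pushforward T Q) a b d
    = transport T (schouten P Q) a b d.
Proof.
move=> uT.
have hPQ x y z := half_schouten_pushforward P Q x y z uT.
have hQP x y z := half_schouten_pushforward Q P x y z uT.
move: hPQ hQP; generalize (pushforward T P) (pushforward T Q) => P' Q' hPQ hQP.
rewrite schoutenE !hPQ !hQP.
rewrite !(transport_cycle T _ a b d) -!(transport_cycle T _ d a b) !transportD.
by apply: eq_bigr => i _; apply: eq_bigr => j _; apply: eq_bigr => l _;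
   rewrite schoutenE.
Qed.

(** * The action on compatible pairs *)

Lemma vfapplyE (v : 'cV[poly3]_3) g : vfapply v g = (v^T *m grad g) 0 0.
Proof.
by rewrite mxE; apply: eq_bigr => i _; rewrite [_^T 0 i]mxE gradE.
Qed.

Lemma vfapply_linfield_pullback K B A F : A *m B = 1%:M ->
  vfapply (linfield (B *m K *m A)) (pullback A F)
    = pullback A (vfapply (linfield K) F).
Proof.
move=> AB1; rewrite !vfapplyE grad_pullback -mulmxA -polymx_mul_linfield.
rewrite trmx_mul mulmxA -(mulmxA _ (polymx B)^T) -trmx_mul -map_mxM AB1.
rewrite map_mx1 trmx1 mulmx1 -pullmx_linfield -pullmx_tr -pullmxM.
by rewrite [LHS]mxE.
Qed.

Lemma cpairs_act T p : T \in unitmx -> cpairs p -> cpairs (act T p).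
Proof.
case: p => K F uT [/= trK hF KF]; split=> /=.
- by rewrite mxtrace_mulC mulmxA mulVmx // mul1mx.
- by apply/dhomogZ/dhomog_pullback.
- have -> v c g : vfapply v (c *: g) = c *: vfapply v g :> poly3.
    by rewrite /vfapply scaler_sumr; apply: eq_bigr => i _; rewrite mderivZ scalerAr.
  by rewrite comp_linE (vfapply_linfield_pullback _ _ (mulVmx uT)) KF rmorph0 scaler0.
Qed.

(** An automorphism fixes pi_(k,f), so compatibility of T.(K,F) with pi_(k,f)
    is the transport of the compatibility of (K,F). *)
Lemma cpairs_of_act k f T p : Aut_pi k f T -> cpairs_of k f p ->
  cpairs_of k f (act T p).
Proof.
move=> [uT Tkf] [hp sch]; split; first exact: cpairs_act.
move=> i j l; rewrite /act /= -pushforward_pi_quad // -{1}Tkf.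
rewrite schouten_pushforward // /transport big1 // => a _.
by rewrite big1 // => b _; rewrite big1 // => d _; rewrite sch rmorph0 mulr0.
Qed.

Lemma pushforward_deformation T k f p : T \in unitmx ->
  pushforward T (deformation k f p)
    = pushforward T (pi_lin k f) + pi_quad (act T p).1 (act T p).2.
Proof.
by move=> uT; rewrite pushforwardD; congr (_ + _); apply: pushforward_pi_quad.
Qed.

(** Pushforward preserves degrees, so an isomorphism of deformations must
    match the linear parts and the quadratic parts separately. *)
Lemma linear_isoP k f p q : f \is 2.-homog -> cpairs p -> cpairs q ->
  linear_iso (deformation k f p) (deformation k f q) <->
  exists2 T, Aut_pi k f T & q = act T p.
Proof.
move=> hf hp hq; split=> [[T uT]|[T [uT Tkf] ->]]; last first.
  by exists T => //; rewrite pushforward_deformation ?Tkf.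
have hTp := cpairs_act uT hp.
rewrite (pushforward_deformation k f p uT) => E.
have hq2 (r : 'M[R]_3 * poly3) : cpairs r -> homog_entries 2 (pi_quad r.1 r.2).
  by case=> _ hF _; apply: homog_pi_quad.
have [Tkf Eq] := homog_entries_split (erefl : 1%N != 2%N)
  (homog_pushforward T (homog_pi_lin k hf)) (homog_pi_lin k hf)
  (hq2 _ hTp) (hq2 _ hq) E.
exists T; first exact: (conj uT Tkf).
exact/esym/(pi_quad_inj hTp hq).
Qed.

(** * Orbits and isomorphism classes *)

Lemma linear_iso_refl P : linear_iso P P.
Proof. by exists 1%:M; rewrite ?unitmx1 // pushforward1. Qed.

Lemma pushforwardK S P : S \in unitmx -> pushforward (invmx S) (pushforward S P) = P.
Proof.
by move=> uS; rewrite -pushforwardM ?unitmx_inv // mulVmx // pushforward1.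
Qed.

Lemma linear_iso_sym P Q : linear_iso P Q -> linear_iso Q P.
Proof.
by case=> T uT <-; exists (invmx T); rewrite ?unitmx_inv // pushforwardK.
Qed.

Lemma linear_iso_trans P Q W : linear_iso P Q -> linear_iso Q W -> linear_iso P W.
Proof.
case=> S uS <- [T uT <-]; exists (T *m S); first by rewrite unitmx_mul uT.
by rewrite pushforwardM.
Qed.

Lemma Aut_pi_subgroup k f : GL_subgroup (@Aut_pi R k f).
Proof.
split.
- by move=> T [].
- by split; rewrite ?unitmx1 // pushforward1.
- move=> S T [uS ES] [uT ET]; split; first by rewrite unitmx_mul uS.
  by rewrite (pushforwardM _ uS uT) ET ES.
- move=> T [uT ET]; split; first by rewrite unitmx_inv.
  by rewrite -{1}ET pushforwardK.
Qed.

Lemma act1 (p : 'M[R]_3 * poly3) : act 1%:M p = p.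
Proof.
case: p => K F; rewrite /act /= invmx1 mul1mx mulmx1 det1 scale1r.
by rewrite comp_linE pullback1.
Qed.

Lemma actM S T (p : 'M[R]_3 * poly3) : S \in unitmx -> T \in unitmx ->
  act (S *m T) p = act S (act T p).
Proof.
case: p => K F uS uT; rewrite /act /= (invrM uS uT : invmx (S *m T) = _) !mulmxA.
by rewrite det_mulmx !comp_linE pullbackZ pullback_comp scalerA.
Qed.

Lemma act_is_action k f : is_action (Aut_pi k f) (@act R) (cpairs_of k f).
Proof.
split=> [T p|p _|S T p [uS _] [uT _] _].
- exact: cpairs_of_act.
- exact: act1.
- exact: actM.
Qed.

Lemma quad_deformation k f p : cpairs_of k f p ->
  quad_deformations k f (deformation k f p).
Proof. by move=> hp; exists p. Qed.

(** A deformation lies in its own class, by reflexivity, so equal classes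
    contain isomorphic structures; symmetry and transitivity give the
    converse. *)
Lemma iso_class_eq k f P Q : quad_deformations k f Q ->
  (iso_class k f P = iso_class k f Q :> set 'M[poly3]_3) <-> linear_iso P Q.
Proof.
move=> hQ; split=> [E|PQ].
  have : iso_class k f Q Q := conj hQ (linear_iso_refl Q).
  by rewrite -E => -[].
apply/seteqP; split=> W [hW iW].
- exact: (conj hW (linear_iso_trans (linear_iso_sym PQ) iW)).
- exact: (conj hW (linear_iso_trans PQ iW)).
Qed.

Lemma act_orbit_eq k f p T : Aut_pi k f T ->
  act_orbit (Aut_pi k f) (@act R) (act T p) = act_orbit (Aut_pi k f) (@act R) p.
Proof.
have [_ _ AM AV] := Aut_pi_subgroup k f.
move=> hT; have [uT _] := hT; apply/seteqP; split=> q [S hS <-].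
  exists (S *m T); first exact: AM.
  by case: hS => uS _; exact: actM.
have [uS _] := hS; exists (S *m invmx T); first by apply: AM => //; apply: AV.
have uST : S *m invmx T \in unitmx by rewrite unitmx_mul uS unitmx_inv.
by rewrite -(actM _ uST uT) -mulmxA (mulVmx uT) mulmx1.
Qed.

(** [linear_isoP] says that two deformations are isomorphic exactly when
    their pairs lie in one orbit, so the map is both well defined and
    injective. *)
Lemma orbit_space_bij k f : f \is 2.-homog ->
  exists Phi : set ('M[R]_3 * poly3) -> set 'M[poly3]_3,
    set_bij (act_orbit_space (Aut_pi k f) (@act R) (cpairs_of k f))
      (iso_classes k f) Phi /\
    (forall p, cpairs_of k f p ->
       Phi (act_orbit (Aut_pi k f) (@act R) p) = iso_class k f (deformation k f p)).
Proof.
move=> hf; pose orb := act_orbit (Aut_pi k f) (@act R).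
(* The union of the classes of all members of the orbit: no representative is
   chosen, and the classes being united are in fact equal. *)
pose Phi (O : set ('M[R]_3 * poly3)) : set 'M[poly3]_3 :=
  [set Q | exists2 p, O p & iso_class k f (deformation k f p) Q].
have PhiE p : cpairs_of k f p -> Phi (orb p) = iso_class k f (deformation k f p).
  move=> hp; apply/seteqP; split=> Q; last first.
    move=> hQ; exists p => //; exists 1%:M; last exact: act1.
    by have [] := Aut_pi_subgroup k f.
  case=> _ [T hT <-]; have hTp := cpairs_of_act hT hp.
  suff iso_pTp : linear_iso (deformation k f p) (deformation k f (act T p)).
    by case=> hQ iQ; exact: (conj hQ (linear_iso_trans iso_pTp iQ)).
  apply/(linear_isoP k hf (proj1 hp) (proj1 hTp)).
  by exists T.
exists Phi; split; last exact: PhiE.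
split.
- move=> _ [p hp <-]; rewrite (PhiE p hp).
  by exists (deformation k f p); first exact: quad_deformation.
- move=> _ _ /set_mem[p hp <-] /set_mem[q hq <-].
  rewrite -/(orb p) -/(orb q) (PhiE p hp) (PhiE q hq).
  move/(iso_class_eq _ (quad_deformation hq)).
  move/(linear_isoP k hf (proj1 hp) (proj1 hq)) => [T hT ->].
  exact/esym/act_orbit_eq.
- move=> _ [_ [p hp <-] <-]; exists (orb p); last exact: PhiE.
  by exists p.
Qed.

End Equivariance.

Theorem theorem3p2 (R : realType) (k : 'cV[R]_3) (f : {mpoly R[3]})
    (hkf : compatible k f) :
  (forall (K1 K2 : 'M[R]_3) (F1 F2 : {mpoly R[3]}),
     cpairs_of k f (K1, F1) -> cpairs_of k f (K2, F2) ->
     (linear_iso (pi_lin k f + pi_quad K1 F1) (pi_lin k f + pi_quad K2 F2) <->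
      exists T : 'M[R]_3,
        [/\ Aut_pi k f T, K2 = T *m K1 *m invmx T
          & F2 = (\det T) *: comp_lin F1 (invmx T)])) /\
  [/\ GL_subgroup (Aut_pi k f),
      is_action (Aut_pi k f) (@act R) (cpairs_of k f)
    & exists Phi : set ('M[R]_3 * {mpoly R[3]}) -> set 'M[{mpoly R[3]}]_3,
        set_bij (act_orbit_space (Aut_pi k f) (@act R) (cpairs_of k f))
          (iso_classes k f) Phi /\
        (forall p, cpairs_of k f p ->
           Phi (act_orbit (Aut_pi k f) (@act R) p) =
           iso_class k f (deformation k f p))].
Proof.
have [hf _] := hkf; split; last first.
  split; [exact: Aut_pi_subgroup | exact: act_is_action | exact: orbit_space_bij].
move=> K1 K2 F1 F2 [c1 _] [c2 _].
apply: iff_trans (linear_isoP k hf c1 c2) _.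
split=> [[T hT [-> ->]] | [T [hT -> ->]]]; first by exists T.
by exists T.
Qed.
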